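(* Let $E\subset[0,1]^2$ be a Barański carpet. Then $E$ is thin for doubling measures, i.e. $\mu(E)=0$ for every doubling measure $\mu$ on $[0,1]^2$.
   Context: Barański carpets: let $p,q\ge 2$ be integers and let $\{a_i\}_{i=1}^p$, $\{b_j\}_{j=1}^q$ be positive numbers with $\sum_{i=1}^p a_i=1$ and $\sum_{j=1}^q b_j=1$. These partition the unit square $[0,1]^2$, by vertical and horizontal lines, into $pq$ closed rectangles $R_{i,j}$ of width $a_i$ and height $b_j$; that is, $R_{i,j}=g_{i,j}([0,1]^2)$ with $g_{i,j}(x,y)=\big(a_ix+\sum_{k<i}a_k,\ b_jy+\sum_{l<j}b_l\big)$. Exclude a sub-collection of these rectangles, with at least one rectangle excluded, and let $S$ be the set of indices $(i,j)$ of the remaining rectangles. Put $E_1=\bigcup_{(i,j)\in S}R_{i,j}$ and iterate, replacing each rectangle of the previous stage by an affine copy of $E_1$: $E_{n+1}=\bigcup_{(i,j)\in S}g_{i,j}(E_n)$. The limit set $E=\bigcap_{n\ge1}E_n$ is called a Barański carpet. A Borel regular measure $\mu$ on a metric space $X$ is doubling if there is a constant $C\ge1$ such that $0<\mu(B(x,2r))\le C\mu(B(x,r))<\infty$ for all $x\in X$ and $0<r<\infty$. Here $X=[0,1]^2$ with the Euclidean metric. *)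

(* Defs.v *)
From HB Require Import structures.
From mathcomp Require Import all_boot all_order all_algebra.
From mathcomp Require Import all_classical all_reals all_analysis.
From mathcomp Require Import ring lra.

Set Implicit Arguments.
Unset Strict Implicit.
Unset Printing Implicit Defensive.

Import Order.TTheory GRing.Theory Num.Theory.

Local Open Scope classical_set_scope.
Local Open Scope ring_scope.

Definition in_unit_square (R : realType) (z : R * R) : bool :=
  (0 <= z.1 <= 1) && (0 <= z.2 <= 1).

(* An alias rather than [set_type] of a subset of [R * R]: the latter inherits
   the max metric of the product, whereas the Euclidean metric is wanted. *)
Definition unit_square (R : realType) : Type :=
  {z : R * R | in_unit_square z}.

HB.instance Definition _ (R : realType) :=
  Choice.copy (unit_square R) {z : R * R | in_unit_square z}.

Definition to_plane (R : realType) (x : unit_square R) : R * R := sval x.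

Definition eucl_dist (R : realType) (z w : R * R) : R :=
  Num.sqrt ((z.1 - w.1) ^+ 2 + (z.2 - w.2) ^+ 2).

Section euclidean_metric.
Variable R : realType.
Implicit Types x y z : unit_square R.

Let dist x y := eucl_dist (to_plane x) (to_plane y).

Let distxx x : dist x x = 0.
Proof. by rewrite /dist /eucl_dist !subrr expr0n /= addr0 sqrtr0. Qed.

Let dist_positivity x y : dist x y = 0 -> x = y.
Proof.
move=> /eqP; rewrite /dist /eucl_dist sqrtr_eq0 => le0; apply: val_inj.
move: le0; rewrite /to_plane /=; case: (sval x) => x1 x2.
case: (sval y) => y1 y2 /= le0.
have h1 := sqr_ge0 (x1 - y1); have h2 := sqr_ge0 (x2 - y2).
have /eqP : (x1 - y1) ^+ 2 = 0 by lra.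
have /eqP : (x2 - y2) ^+ 2 = 0 by lra.
by rewrite !sqrf_eq0 !subr_eq0 => /eqP -> /eqP ->.
Qed.

Let dist_sym x y : dist x y = dist y x.
Proof. by rewrite /dist /eucl_dist -sqrrN opprB -[in X in _ + X]sqrrN opprB. Qed.

Let sqrt_minkowski (a b c d : R) :
  Num.sqrt ((a + c) ^+ 2 + (b + d) ^+ 2) <=
  Num.sqrt (a ^+ 2 + b ^+ 2) + Num.sqrt (c ^+ 2 + d ^+ 2).
Proof.
have ge0 (u v : R) : 0 <= u ^+ 2 + v ^+ 2 by rewrite addr_ge0 ?sqr_ge0.
rewrite -(@ler_pXn2r _ 2) ?nnegrE ?addr_ge0 ?sqrtr_ge0 //.
rewrite [leRHS]sqrrD !sqr_sqrtr //.
have : a * c + b * d <=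
    Num.sqrt (a ^+ 2 + b ^+ 2) * Num.sqrt (c ^+ 2 + d ^+ 2).
  rewrite -sqrtrM //; apply: (le_trans (ler_norm _)).
  rewrite -sqrtr_sqr; apply: ler_wsqrtr.
  rewrite -subr_ge0; set D := (X in 0 <= X).
  have -> : D = (a * d - b * c) ^+ 2 by rewrite /D; ring.
  exact: sqr_ge0.
set t := Num.sqrt _ * Num.sqrt _ => le_t.
rewrite -subr_ge0; set D := (X in 0 <= X).
have -> : D = (t - (a * c + b * d)) *+ 2 by rewrite /D; ring.
by rewrite mulrn_wge0 // subr_ge0.
Qed.

Let dist_triangle y x z : dist x z <= dist x y + dist y z.
Proof.
rewrite /dist /eucl_dist; move: (to_plane x) (to_plane y) (to_plane z).
move=> [x1 x2] [y1 y2] [z1 z2] /=.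
have := sqrt_minkowski (x1 - y1) (x2 - y2) (y1 - z1) (y2 - z2).
by rewrite !addrA !subrK.
Qed.

HB.instance Definition _ := isMetric.Build R (unit_square R)
  distxx dist_positivity dist_sym dist_triangle.

End euclidean_metric.

(* "Measure" is meant as in geometric measure theory: an outer measure, all of
   whose Borel sets are Caratheodory measurable and for which every set has a
   Borel hull of the same measure. *)
Definition borel_regular (R : realType) (X : topologicalType)
    (mu : {outer_measure set X -> \bar R}) : Prop :=
  <<s open >> `<=` mu.-caratheodory /\
  forall A : set X, exists B : set X,
    [/\ <<s open >> B, A `<=` B & mu B = mu A].

Definition doubling (R : realType) (X : metricType R)
    (mu : {outer_measure set X -> \bar R}) : Prop :=
  borel_regular mu /\
  exists2 C : R, 1 <= C & forall (x : X) (r : R), 0 < r ->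
    [/\ (0 < mu (ball x (2 * r)%R))%E,
        (mu (ball x (2 * r)%R) <= C%:E * mu (ball x r))%E
      & (C%:E * mu (ball x r) < +oo)%E].

Definition thin_for_doubling (R : realType) (X : metricType R) (A : set X) :
    Prop :=
  forall mu : {outer_measure set X -> \bar R}, doubling mu -> mu A = 0%E.

Definition cell_map (R : realType) (p q : nat) (a : 'I_p -> R) (b : 'I_q -> R)
    (ij : 'I_p * 'I_q) (z : R * R) : R * R :=
  (a ij.1 * z.1 + \sum_(k < p | (k < ij.1)%N) a k,
   b ij.2 * z.2 + \sum_(l < q | (l < ij.2)%N) b l).

(* Stage 0 is the whole square, so that stage 1 is the union of the retained
   rectangles [cell_map a b ij @` [0, 1]^2]. *)
Fixpoint carpet_stage (R : realType) (p q : nat) (a : 'I_p -> R)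
    (b : 'I_q -> R) (S : {set 'I_p * 'I_q}) (n : nat) : set (R * R) :=
  if n is m.+1 then
    \bigcup_(ij in [set` S]) (cell_map a b ij @` carpet_stage a b S m)
  else [set z | in_unit_square z].

Definition is_baranski_carpet (R : realType) (E : set (R * R)) : Prop :=
  exists (p q : nat) (a : 'I_p -> R) (b : 'I_q -> R) (S : {set 'I_p * 'I_q}),
    [/\ (2 <= p)%N /\ (2 <= q)%N,
        (forall i, 0 < a i) /\ \sum_(i < p) a i = 1,
        (forall j, 0 < b j) /\ \sum_(j < q) b j = 1,
        (exists ij, ij \notin S)
      & E = \bigcap_(n in [set n | (1 <= n)%N]) carpet_stage a b S n].

(* Main.v *)
Require Import Defs.
From HB Require Import structures.
From mathcomp Require Import all_boot all_order all_algebra.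
From mathcomp Require Import all_classical all_reals all_analysis.
From mathcomp Require Import ring lra.

(** A doubling measure charges every set [G] that is thick near a set [F] by a
    fixed proportion of the mass of [F]: if around each point of [F] some ball
    of radius [r] contains a ball of radius [c * r] lying in [G], then
    [mu F <= K * mu G], where [K] depends only on [c] and the doubling constant
    ([thick_comparison], a Vitali argument).

    Fix an excluded rectangle [(i0, j0)].  For any word [u] of [n] column digits
    and any word [v] of [n] row digits, the open rectangle of the words [u i0]
    and [v j0] misses the carpet, since it misses its stage [n + 1]
    ([carpet_avoids_holes]); call it a hole of level [n].  The carpet thus lies
    in the closed set [A] of the points that are interior to no union of holes
    of one level.

    If all rectangles were nearly square, the holes of level [n] would be thick
    near every point, at a scale tending to [0] with [n].  The rectangles may
    however be arbitrarily elongated, and a doubling measure need not give the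
    two ends of a long thin rectangle comparable masses.  The holes are therefore
    reached in two steps.  Consider a point in a rectangle of width [w] and
    height [h], with [w <= h].  At scale [h] there is near it a square made of
    strips, each contained in a level [n] rectangle of width at most [h / m],
    with [m] a lower bound for all the ratios, and in its row [j0]; the widths
    are controlled by passing to a shorter prefix of the column word, whose
    interval has length about [h] ([coarse_interval], [box_near_strip]).  A point of such a strip, of
    width [w'], sees at scale [w'] the hole in that strip: the hole is as tall as
    the strip, and of comparable width ([box_near_hole]).  Each step is an
    instance of the comparison above, so the union of the holes of level [n] that
    are close to [A] has mass at least [mu A / K ^ 2].

    These holes lie in a thin neighborhood of [A], outside [A]; as [A] is closed
    and [mu] finite, the mass of this shell tends to [0] with its thickness
    ([outer_measure_shell_eq0]).  Hence [mu A = 0]. *)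

Set Implicit Arguments.
Unset Strict Implicit.
Unset Printing Implicit Defensive.

Import Order.TTheory GRing.Theory Num.Theory.
Import numFieldNormedType.Exports.

Local Open Scope classical_set_scope.
Local Open Scope ring_scope.

(** * Balls and neighborhoods in metric spaces *)

Section metric_balls.
Context {R : realType} {X : metricType R}.
Implicit Types (x y : X) (r e : R).

Lemma metric_ball_open x r : open (ball x r).
Proof.
rewrite openE => y; rewrite ballEmdist /= => xy.
apply/nbhs_ballP; exists (r - mdist x y) => /=; first by rewrite subr_gt0.
move=> z; rewrite !ballEmdist /= => yz.
apply: le_lt_trans (metric_triangle x y z) _; lra.
Qed.

Lemma ball_sub_ball x y r e : ball x e y -> ball x r `<=` ball y (r + e).
Proof.
move=> xy z xz; rewrite addrC; apply: ball_triangle xz.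
exact: ball_sym.
Qed.

Definition neighborhood (A : set X) r : set X := \bigcup_(x in A) ball x r.

Lemma neighborhood_open A r : open (neighborhood A r).
Proof. by apply: bigcup_open => x _; exact: metric_ball_open. Qed.

Lemma closed_bigcap_neighborhood (A : set X) (d : nat -> R) :
  closed A -> d @ \oo --> (0 : R) ->
  \bigcap_n (neighborhood A (d n)) `<=` A.
Proof.
move=> clA d0 x xA; suff : closure A x by rewrite -(closure_id A).1.
move=> B /nbhs_ballP [e /= e0 xB].
have [n _ dne] : \forall n \near \oo, d n < e.
  by move/cvgrPdist_lt : d0 => /(_ e e0); apply: filterS => n;
    rewrite sub0r normrN; apply: le_lt_trans; exact: ler_norm.
have [y Ay yx] := xA n I; exists y; split=> //; apply: xB.
by apply: le_ball (ball_sym yx); apply: ltW; exact: dne (leqnn n).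
Qed.

End metric_balls.

(** * Outer measures *)

Section outer_measure.
Context {R : realType}.

Lemma outer_measureU_le (T : Type) (mu : {outer_measure set T -> \bar R})
  (A B : set T) : (mu (A `|` B) <= mu A + mu B)%E.
Proof.
(* All sets past the first two are empty: the series has two nonzero terms. *)
rewrite -bigcup2E; apply: le_trans (outer_measure_sigma_subadditive mu _) _.
rewrite le_eqVlt; apply/orP; left; apply/eqP.
apply/cvg_lim => //; rewrite -(cvg_shiftn 2)/=; apply: cvg_near_cst.
apply: nearW => k; rewrite big_mkord addn2 2!big_ord_recl big1 ?adde0//.
by move=> ? _; exact: outer_measure0.
Qed.

(** Continuity from above of the measure that [mu] induces on its Caratheodory
    sets; the point [x0] is there because measurable types are pointed. *)
Lemma caratheodory_nonincreasing_cvg0 (T : choiceType) (x0 : T)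
    (mu : {outer_measure set T -> \bar R}) (F : (set T)^nat) :
  (mu (F 0%N) < +oo)%E -> (forall n, mu.-caratheodory (F n)) ->
  nonincreasing_seq F -> \bigcap_n F n = set0 ->
  mu \o F @ \oo --> 0%E.
Proof.
move=> F0 mF niF F00.
pose pT : pointedType := HB.pack T (isPointed.Build T x0).
pose nu : {outer_measure set pT -> \bar R} := mu.
have mF0 : nu.-caratheodory (\bigcap_n F n).
  by rewrite F00; exact: caratheodory_measurable_set0.
have : nu \o F @ \oo --> nu (\bigcap_n F n) :=
  @nonincreasing_cvg_mu _ (caratheodory_type nu) R
    (nu : {measure set (caratheodory_type nu) -> \bar R}) F F0 mF mF0 niF.
by rewrite F00 outer_measure0.
Qed.

End outer_measure.

(** * Comparison of masses under a doubling condition *)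

Section vitali.
Context {R : realType} {X : metricType R}.
Variable mu : {outer_measure set X -> \bar R}.

Lemma seq_argmax (r : X -> R) (s : seq X) : s != [::] ->
  exists2 x, x \in s & forall y, y \in s -> r y <= r x.
Proof.
elim: s => // a [|b s] IH _.
  by exists a => [|y]; rewrite ?inE // => /eqP ->.
have [x xs xmax] := IH isT; have [rax|rxa] := leP (r a) (r x).
  by exists x => [|y]; rewrite inE ?xs ?orbT // => /orP[/eqP->|/xmax].
exists a => [|y]; rewrite inE ?eqxx // => /orP[/eqP->//|/xmax ryx].
exact: le_trans ryx (ltW rxa).
Qed.

(** The greedy selection of Vitali's covering lemma, run on masses rather than
    on families of balls.  The balls of [s] that meet the largest one are
    covered by its threefold dilation; those disjoint from it are handled by
    induction.  As the largest ball is Caratheodory measurable, the two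
    contributions on the right add up. *)
Lemma vitali_comparison (G : set X) (r : X -> R) (K : R) (s : seq X) :
  0 <= K -> (forall x, mu.-caratheodory (ball x (r x))) ->
  (forall x, x \in s ->
     (mu (ball x (3 * r x)) <= K%:E * mu (ball x (r x) `&` G))%E) ->
  (mu (\bigcup_(x in [set` s]) ball x (r x)) <=
   K%:E * mu ((\bigcup_(x in [set` s]) ball x (r x)) `&` G))%E.
Proof.
move=> K0 mB.
have [n] := ubnP (size s); elim: n s => // n IH s sn hs.
have [->|s0] := eqVneq s [::].
  by rewrite set_nil bigcup_set0 set0I outer_measure0 mule_ge0 ?lee_fin
    ?outer_measure_ge0.
have [x xs xmax] := seq_argmax r s0.
pose s' := [seq y <- s | `[< ball x (r x) `&` ball y (r y) = set0 >]].
set U := \bigcup_(y in [set` s]) _.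
pose U' := \bigcup_(y in [set` s']) ball y (r y).
have xU : ball x (r x) `<=` U by move=> z xz; exists x.
have U'U : U' `<=` U.
  by move=> z [y /=]; rewrite mem_filter => /andP[_ ys] yz; exists y.
have U'x : U' `<=` ~` ball x (r x).
  move=> z [y /=]; rewrite mem_filter => /andP[/asboolP dis _] yz xz.
  by have : set0 z by rewrite -dis.
have [rx0|rx0] := leP (r x) 0.
  have -> : U = set0.
    rewrite -subset0 => z [y /= ys]; rewrite ballEmdist /= => yz.
    have := xmax _ ys; have := mdist_ge0 y z; lra.
  by rewrite set0I outer_measure0 mule_ge0 ?lee_fin
    ?outer_measure_ge0.
(* A ball meeting the largest ball, and no larger than it, is within three
   times its radius. *)
have UU : U `<=` ball x (3 * r x) `|` U'.
  move=> z [y /= ys yz].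
  have [dis|/eqP/set0P[w [xw yw]]] :=
      pselect (ball x (r x) `&` ball y (r y) = set0).
    by right; exists y => //=; rewrite mem_filter ys andbT; apply/asboolP.
  left; have ryx := xmax _ ys.
  have xy := ball_triangle xw (ball_sym yw).
  by apply: le_ball (ball_triangle xy yz); lra.
have s's : (size s' < n)%N.
  rewrite -ltnS; apply: leq_trans sn.
  rewrite ltnS size_filter ltn_neqAle count_size andbT -all_count; apply/allPn; exists x => //; apply/asboolPn => xx.
  by have : set0 x by rewrite -xx; split; exact: ballxx.
apply: le_trans (le_outer_measure mu _ _ UU) _.
apply: le_trans (outer_measureU_le _ _ _) _.
apply: le_trans (leeD (hs _ xs) (IH s' s's _)) _.
  by move=> y; rewrite mem_filter => /andP[_]; exact: hs.
rewrite -ge0_muleDr ?outer_measure_ge0 // lee_wpmul2l ?lee_fin //.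
rewrite (mB x (U `&` G)); apply: leeD; apply: le_outer_measure => z [].
  by move=> xz Gz; split => //; split => //; exact: xU.
by move=> U'z Gz; split; [split => //; exact: U'U|exact: U'x].
Qed.

Lemma doubling_iter (C : R) (x : X) (r : R) (k : nat) : 0 <= C -> 0 < r ->
  (forall x r, 0 < r -> (mu (ball x (2 * r)) <= C%:E * mu (ball x r))%E) ->
  (mu (ball x (2 ^+ k * r)) <= (C ^+ k)%:E * mu (ball x r))%E.
Proof.
move=> C0 r0 hC; elim: k => [|k IH]; first by rewrite !expr0 !mul1r mul1e.
rewrite !exprS -mulrA EFinM -muleA.
apply: le_trans (hC _ _ _) _; first by rewrite mulr_gt0 // exprn_gt0.
by rewrite lee_wpmul2l ?lee_fin.
Qed.

(** The radii are bounded below by [rmin], so a finite [rmin]-net of [F] already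
    gives a covering by the balls of radius [r], to which the finite comparison
    applies.  The exponent [k] counts the
    doublings that take a ball of radius [c * r] to one of radius [4 * r], which
    contains the threefold dilation of the ball around the point of [F]. *)
Lemma thick_comparison (C c rmin : R) (k : nat) (F G : set X) :
  0 <= C -> (forall x r, mu.-caratheodory (ball x r)) ->
  (forall x r, 0 < r -> (mu (ball x (2 * r)) <= C%:E * mu (ball x r))%E) ->
  0 < c -> 4 <= 2 ^+ k * c -> 0 < rmin ->
  (exists2 s : seq X, [set` s] `<=` F &
     F `<=` \bigcup_(x in [set` s]) ball x rmin) ->
  (forall x, F x -> exists r y,
     rmin <= r /\ ball y (c * r) `<=` ball x r `&` G) ->
  (mu F <= (C ^+ k)%:E * mu G)%E.
Proof.
move=> C0 mB hC c0 kc rmin0 [s sF Fs] thick.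
have {thick} [r hr] : {r : X -> R & forall x, F x -> exists y,
     rmin <= r x /\ ball y (c * r x) `<=` ball x (r x) `&` G}.
  apply: (@choice X R (fun x rx => F x -> exists y,
     rmin <= rx /\ ball y (c * rx) `<=` ball x rx `&` G)) => x.
  have [Fx|nFx] := pselect (F x); last by exists 0.
  by have [rx ?] := thick x Fx; exists rx.
have Fcov : F `<=` \bigcup_(x in [set` s]) ball x (r x).
  move=> z /Fs [x xs xz]; exists x => //; apply: le_ball xz.
  by have [y []] := hr _ (sF _ xs).
apply: le_trans (le_outer_measure mu _ _ Fcov) _.
apply: (@le_trans _ _ ((C ^+ k)%:E * mu
    ((\bigcup_(x in [set` s]) ball x (r x)) `&` G))%E); last first.
  rewrite lee_wpmul2l ?lee_fin ?exprn_ge0 //; apply: le_outer_measure.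
  exact: subIsetr.
apply: vitali_comparison; [exact: exprn_ge0|by move=> x; exact: mB|].
move=> x xs; have [y [rx yG]] := hr _ (sF _ xs).
have rx0 : 0 < r x by lra.
have crx0 : 0 < c * r x by rewrite mulr_gt0.
have [xy _] := yG _ (ballxx y crx0).
apply: (@le_trans _ _ (mu (ball y (2 ^+ k * (c * r x))))).
  apply: le_outer_measure; apply: subset_trans (ball_sub_ball xy) _.
  apply: le_ball; rewrite mulrA.
  have : 4 * r x <= 2 ^+ k * c * r x by rewrite ler_pM2r.
  lra.
apply: le_trans (doubling_iter _ _ _ _ hC) _ => //.
by rewrite lee_wpmul2l ?lee_fin ?exprn_ge0 // le_outer_measure.
Qed.

End vitali.

(** The shells [neighborhood A (d n) `\` A] decrease to the empty set because
    [A] is closed, so their masses tend to [0]; a set whose mass is dominated by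
    a fixed multiple of each of them is null. *)
Lemma outer_measure_shell_eq0 {R : realType} {X : metricType R}
    (mu : {outer_measure set X -> \bar R}) (A : set X) (K : R) (d : nat -> R) :
  0 <= K -> (mu setT < +oo)%E -> (forall U, open U -> mu.-caratheodory U) ->
  closed A -> nonincreasing_seq d -> d @ \oo --> (0 : R) ->
  (forall n, (mu A <= K%:E * mu (neighborhood A (d n) `\` A))%E) ->
  mu A = 0%E.
Proof.
move=> K0 muT mO clA dni d0 hA.
have [->|/set0P[x0 _]] := eqVneq A set0; first exact: outer_measure0.
pose F n := neighborhood A (d n) `\` A.
have F0 : mu \o F @ \oo --> 0%E.
  apply: (caratheodory_nonincreasing_cvg0 x0).
  - by apply: le_lt_trans muT; exact: le_outer_measure.
  - move=> n; apply: caratheodory_measurable_setI; first exact/mO/neighborhood_open.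
    exact/mO/closed_openC.
  - move=> k l kl; apply/subsetPset; apply: setSD => z [x Ax xz]; exists x => //.
    by apply: le_ball xz; exact: dni.
  - rewrite -subset0 => z Fz; have [_] := Fz 0%N I; apply.
    by apply: (closed_bigcap_neighborhood clA d0) => n _; have [] := Fz n I.
apply/eqP; rewrite eq_le outer_measure_ge0 andbT.
have KF : (K%:E * mu (F n) @[n --> \oo] --> K%:E * 0)%E by apply: cvgeZl.
rewrite -(mule0 K%:E) -(cvg_lim _ KF) //.
apply: lime_ge; first by apply/cvg_ex; exists (K%:E * 0)%E.
exact: nearW.
Qed.

(** * Subdivisions of the unit interval *)

Section subdivision.
Context {R : realType} {p : nat}.
Variable a : 'I_p -> R.

Definition offset (k : nat) : R := \sum_(i < p | (i < k)%N) a i.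

Lemma offset0 : offset 0 = 0.
Proof. by rewrite /offset big_pred0. Qed.

Lemma offsetS (i : 'I_p) : offset i.+1 = offset i + a i.
Proof.
rewrite /offset (bigD1 i) //= addrC; congr (_ + _).
by apply: eq_bigl => k; rewrite ltnS ltn_neqAle andbC -(inj_eq val_inj).
Qed.

Lemma offset_total : offset p = \sum_i a i.
Proof. by apply: eq_bigl => i; rewrite ltn_ord. Qed.

Hypothesis a_gt0 : forall i, 0 < a i.
Hypothesis a_sum1 : \sum_i a i = 1.

Lemma offset_le k l : (k <= l)%N -> offset k <= offset l.
Proof.
move=> kl; rewrite /offset [leRHS](bigID (fun i : 'I_p => (i < k)%N)) /=.
rewrite [X in _ <= X + _](eq_bigl (fun i : 'I_p => (i < k)%N)); last first.
  by move=> i; rewrite andbC; case: (boolP (i < k)%N) => //= /leq_trans ->.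
by rewrite lerDl; apply: sumr_ge0 => i _; exact: ltW.
Qed.

Lemma offset_ge0 k : 0 <= offset k.
Proof. by rewrite -offset0; exact: offset_le. Qed.

Lemma offset_digit_le1 (i : 'I_p) : offset i + a i <= 1.
Proof. by rewrite -offsetS -a_sum1 -offset_total offset_le. Qed.

Lemma digit_exists t : 0 <= t <= 1 ->
  exists i : 'I_p, offset i <= t <= offset i + a i.
Proof.
move=> /andP[t0 t1].
have ex : exists k, t <= offset k by exists p; rewrite offset_total a_sum1.
case: (ex_minnP ex) => -[|k] tk kmin.
  have p0 : (0 < p)%N.
    rewrite lt0n; apply/eqP => p0.
    have := a_sum1; rewrite -offset_total p0 offset0 => /esym/eqP.
    by rewrite oner_eq0.
  exists (Ordinal p0); rewrite -offsetS (le_trans tk) ?offset_le //=.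
  by rewrite offset0 t0.
have kp : (k < p)%N by rewrite (kmin p) // offset_total a_sum1.
exists (Ordinal kp); rewrite -offsetS tk andbT /= ltW // ltNge.
by apply/negP => /kmin; rewrite ltnn.
Qed.

(** Only one of the two intervals is open, so two digits may share an end point
    but not an interior one. *)
Lemma digit_unique (i j : 'I_p) t :
  offset i < t < offset i + a i -> offset j <= t <= offset j + a j -> i = j.
Proof.
rewrite -!offsetS => /andP[it ti] /andP[jt tj].
apply/val_inj/eqP; rewrite eqn_leq.
apply/andP; split; rewrite leqNgt; apply/negP => /offset_le h; have := a_gt0 i; lra.
Qed.

(** The pairs [(u, w)] encode the intervals [[u, u + w]] of the [n]-th
    subdivision.  The outermost digit is split off first, as in
    [carpet_stage]. *)
Fixpoint cell (n : nat) (u w : R) : Prop :=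
  if n is k.+1 then
    exists i u' w', [/\ cell k u' w', u = a i * u' + offset i & w = a i * w']
  else u = 0 /\ w = 1.

Lemma cell_sub_unit n u w : cell n u w -> [/\ 0 <= u, 0 < w & u + w <= 1].
Proof.
elim: n u w => [|n IH] u w /=; first by move=> [-> ->]; split; lra.
move=> [i [u' [w' [/IH [u0 w0 uw] -> ->]]]].
have ai := a_gt0 i; have ci := offset_ge0 i; have ci1 := offset_digit_le1 i.
have : a i * (u' + w') <= a i by rewrite ger_pMr.
split; [|exact: mulr_gt0|lra].
by rewrite addr_ge0 // mulr_ge0 // ltW.
Qed.

Lemma cell_cover n t : 0 <= t <= 1 ->
  exists u w, cell n u w /\ u <= t <= u + w.
Proof.
elim: n t => [|n IH] t t01 /=; first by exists 0, 1; rewrite add0r.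
have [i /andP[it ti]] := digit_exists t01; have ai := a_gt0 i.
pose t' := (t - offset i) / a i.
have tE : t = a i * t' + offset i by rewrite /t'; field; rewrite gt_eqF.
have [|u [w [uw /andP[ut tw]]]] := IH t'.
  rewrite /t' divr_ge0 ?subr_ge0 ?(ltW ai) //= ler_pdivrMr //; lra.
exists (a i * u + offset i), (a i * w); split; first by exists i, u, w.
have : a i * u <= a i * t' by rewrite ler_pM2l.
have : a i * t' <= a i * (u + w) by rewrite ler_pM2l.
lra.
Qed.

Section width_bounds.
Variable m : R.
Hypotheses (m_gt0 : 0 < m) (a_ge : forall i, m <= a i).

Lemma cell_width_ge n u w : cell n u w -> m ^+ n <= w.
Proof.
elim: n u w => [|n IH] u w /=; first by move=> [_ ->]; rewrite expr0.
move=> [i [u' [w' [/IH h _ ->]]]]; rewrite exprS.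
by apply: ler_pM => //; [exact: ltW|exact/ltW/exprn_gt0].
Qed.

Lemma cell_width_le n u w : (2 <= p)%N -> cell n u w -> w <= (1 - m) ^+ n.
Proof.
move=> p2; elim: n u w => [|n IH] u w /=; first by move=> [_ ->]; rewrite expr0.
move=> [i [u' [w' [c _ ->]]]]; have [_ w0 _] := cell_sub_unit c.
rewrite exprS; apply: ler_pM; [exact: ltW|exact: ltW| |exact: IH c].
have [j ji] : exists j : 'I_p, j != i.
  have p0 : (0 < p)%N by apply: leq_trans p2.
  have [->|i0] := eqVneq i (Ordinal p0); first by exists (Ordinal p2).
  by exists (Ordinal p0); rewrite eq_sym.
have := a_sum1; rewrite (bigD1 i) //= (bigD1 j) //=.
have := a_ge j; set s := \sum_(_ | _) _.
have : 0 <= s by apply: sumr_ge0 => k _; exact: ltW.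
lra.
Qed.

(** The interval of length [l] is that of the first prefix of the word of
    [[u, u + w]] whose next digit would bring the length down to [s] or less.
    That digit multiplies the length by at least [m], whence [m * l <= s].  Every
    word extending this prefix has an interval no longer than [l]. *)
Lemma coarse_interval n t u w s :
  cell n u w -> u <= t <= u + w -> w <= s -> s <= 1 ->
  exists v l, [/\ 0 <= v, v + l <= 1, v <= t <= v + l, s <= l & m * l <= s] /\
    forall t', v <= t' <= v + l ->
      exists u' w', [/\ cell n u' w', u' <= t' <= u' + w' & w' <= l].
Proof.
elim: n t u w s => [|n IH] t u w s.
  move=> [-> ->]; rewrite add0r => t01 s1 s1'.
  have m1 : m <= 1.
    have [i _] := digit_exists t01.
    have := a_ge i; have := offset_digit_le1 i; have := offset_ge0 i; lra.
  exists 0, 1; split; first by split; lra.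
  by move=> t' ht'; exists 0, 1; split.
move=> cw /andP[ut tw] ws s1.
have [u0 w0 uw1] := cell_sub_unit cw.
move: cw ut tw ws => [i [u' [w' [c uE wE]]]] ut tw ws.
have ai := a_gt0 i; have mai := a_ge i.
(* If one digit is already short enough, the empty prefix is the right one. *)
have [ais|sai] := leP (a i) s.
  exists 0, 1; split; first by split; lra.
  move=> t' t'01; have [|u1 [w1 [c1 t1]]] := @cell_cover n.+1 t'; first by lra.
  have [? ? ?] := cell_sub_unit c1.
  by exists u1, w1; split=> //; lra.
pose t' := (t - offset i) / a i.
have tE : t = a i * t' + offset i by rewrite /t'; field; rewrite gt_eqF.
pose s' := s / a i.
have sE : s = a i * s' by rewrite /s'; field; rewrite gt_eqF.
have [|||v [l [[v0 vl1 /andP[vt tl] sl ml] cov]]] := IH t' u' w' s' c.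
- apply/andP; split; rewrite -(ler_pM2l ai); lra.
- by rewrite -(ler_pM2l ai) -sE -wE.
- by rewrite -(ler_pM2l ai); lra.
exists (a i * v + offset i), (a i * l); split.
  have ci := offset_ge0 i; have ci1 := offset_digit_le1 i.
  have h1 : a i * (v + l) <= a i * 1 by rewrite ler_pM2l.
  have h2 : a i * v <= a i * t' by rewrite ler_pM2l.
  have h3 : a i * t' <= a i * (v + l) by rewrite ler_pM2l.
  have h4 : a i * s' <= a i * l by rewrite ler_pM2l.
  have h5 : a i * (m * l) <= a i * s' by rewrite ler_pM2l.
  have h6 : 0 <= a i * v by rewrite mulr_ge0 // ltW.
  by split; lra.
move=> x /andP[vx xl]; pose x' := (x - offset i) / a i.
have xE : x = a i * x' + offset i by rewrite /x'; field; rewrite gt_eqF.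
have [|u1 [w1 [c1 /andP[ux xw] w1l]]] := cov x'.
  by apply/andP; split; rewrite -(ler_pM2l ai); lra.
exists (a i * u1 + offset i), (a i * w1); split.
- by exists i, u1, w1.
- have h2 : a i * u1 <= a i * x' by rewrite ler_pM2l.
  have h3 : a i * x' <= a i * (u1 + w1) by rewrite ler_pM2l.
  lra.
- by rewrite ler_pM2l.
Qed.

End width_bounds.

(** The interior of the [i]-th child of the cell [[u, u + w]]. *)
Definition in_hole (i : 'I_p) (u w t : R) : bool :=
  u + w * offset i < t < u + w * (offset i + a i).

Lemma in_hole_in_cell i n u w t : cell n u w -> in_hole i u w t ->
  u < t < u + w.
Proof.
move=> /cell_sub_unit[u0 w0 uw1] /andP[h1 h2].
have h3 : 0 <= w * offset i by rewrite mulr_ge0 ?offset_ge0 // ltW.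
have h4 : w * (offset i + a i) <= w by rewrite ger_pMr // offset_digit_le1.
lra.
Qed.

Lemma in_hole_first_digit i j n u w t : cell n u w ->
  in_hole i (a j * u + offset j) (a j * w) t ->
  offset j < t < offset j + a j.
Proof.
move=> c h; have aj := a_gt0 j; have [u0 _ uw1] := cell_sub_unit c.
have /andP[h1 h2] : a j * u + offset j < t < a j * u + offset j + a j * w.
  by apply: (@in_hole_in_cell i n.+1) => //; exists j, u, w.
have : 0 <= a j * u by rewrite mulr_ge0 // ltW.
have : a j * (u + w) <= a j by rewrite ger_pMr.
lra.
Qed.

Lemma in_hole_rescale i j u w t :
  in_hole i (a j * u + offset j) (a j * w) (a j * t + offset j) =
  in_hole i u w t.
Proof.
rewrite /in_hole; congr (_ && _);
  rewrite -[RHS](ltr_pM2l (a_gt0 j)) -[RHS](ltrD2r (offset j));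
  by congr (_ < _); ring.
Qed.

End subdivision.

(** * Rectangles avoided by the carpet *)

Section carpet.
Context {R : realType} {p q : nat}.
Variables (a : 'I_p -> R) (b : 'I_q -> R) (S : {set 'I_p * 'I_q}).
Hypotheses (a_gt0 : forall i, 0 < a i) (a_sum1 : \sum_i a i = 1).
Hypotheses (b_gt0 : forall j, 0 < b j) (b_sum1 : \sum_j b j = 1).

Lemma cell_map_unit_square (ij : 'I_p * 'I_q) (z : R * R) : in_unit_square z ->
  (offset a ij.1 <= (cell_map a b ij z).1 <= offset a ij.1 + a ij.1) &&
  (offset b ij.2 <= (cell_map a b ij z).2 <= offset b ij.2 + b ij.2).
Proof.
move=> /andP[/andP[x0 x1] /andP[y0 y1]]; rewrite /cell_map /= -!/(offset _ _).
have h1 : 0 <= a ij.1 * z.1 by rewrite mulr_ge0 // ltW.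
have h2 : 0 <= b ij.2 * z.2 by rewrite mulr_ge0 // ltW.
have h3 : a ij.1 * z.1 <= a ij.1 by rewrite ger_pMr.
have h4 : b ij.2 * z.2 <= b ij.2 by rewrite ger_pMr.
by apply/andP; split; lra.
Qed.

Lemma carpet_stage_unit_square n z : carpet_stage a b S n z -> in_unit_square z.
Proof.
elim: n z => [|n IH] z //= [ij _ [z' /IH z'1 <-]].
have /andP[/andP[h1 h2] /andP[h3 h4]] := cell_map_unit_square ij z'1.
have := offset_ge0 a_gt0 ij.1; have := offset_ge0 b_gt0 ij.2.
have := offset_digit_le1 a_gt0 a_sum1 ij.1.
have := offset_digit_le1 b_gt0 b_sum1 ij.2.
by rewrite /in_unit_square => *; apply/andP; split; apply/andP; split; lra.
Qed.

(** A point of stage [n + 1] lies in a closed rectangle given by [n + 1]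
    retained pairs of digits.  Being interior to the rectangle of the words of
    the hole, it has the same digits as the hole, level by level; the last pair
    would then be [(i0, j0)]. *)
Lemma carpet_avoids_holes i0 j0 n u w v h z : (i0, j0) \notin S ->
  cell a n u w -> cell b n v h ->
  in_hole a i0 u w z.1 -> in_hole b j0 v h z.2 ->
  ~ carpet_stage a b S n.+1 z.
Proof.
move=> ijS; elim: n u w v h z => [|n IH] u w v h z cu cv hu hv.
  case: cu cv hu hv => -> -> [-> ->]; rewrite /in_hole !add0r !mul1r => hu hv.
  move=> [[i j] /= ij [z' z'1 zE]].
  have /andP[h1 h2] := cell_map_unit_square (i, j) z'1.
  rewrite zE in h1 h2; move/negP: ijS; apply.
  by rewrite (digit_unique a_gt0 hu h1) (digit_unique b_gt0 hv h2).
move: cu cv hu hv => /= [i [u' [w' [cu -> ->]]]] [j [v' [h' [cv -> ->]]]] hu hv.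
move=> [[k l] /= kl [z' z'st zE]].
have z'1 := @carpet_stage_unit_square n.+1 _ z'st.
have /andP[h1 h2] := cell_map_unit_square (k, l) z'1.
rewrite zE in h1 h2.
have ki := digit_unique a_gt0 (in_hole_first_digit a_gt0 a_sum1 cu hu) h1.
have lj := digit_unique b_gt0 (in_hole_first_digit b_gt0 b_sum1 cv hv) h2.
rewrite /= in ki lj; move: hu hv; rewrite -zE /cell_map /= -!/(offset _ _) ki lj.
rewrite !in_hole_rescale // => hu hv.
exact: IH cu cv hu hv z'st.
Qed.

End carpet.

(** * Two-scale search for holes *)

Section boxes.
Context {R : realType}.
Implicit Types (x y z : R).

Lemma inner_point v l t rho : v <= t <= v + l -> 0 <= rho -> 2 * rho <= l ->
  exists z, [/\ `|z - t| <= rho, v <= z - rho & z + rho <= v + l].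
Proof.
move=> /andP[vt tl] rho0 rhol.
have [h1|h1] := ltP t (v + rho).
  by exists (v + rho); split; rewrite ?ler_norml; lra.
have [h2|h2] := ltP (v + l - rho) t.
  by exists (v + l - rho); split; rewrite ?ler_norml; lra.
by exists t; split; rewrite ?ler_norml; lra.
Qed.

(** The square of half-side [c * r] around [(z1, z2)] lies in the unit square
    and in [P], and the coordinates of its points differ by at most [r / 2] from
    those of [(x1, x2)], so that it is contained in the Euclidean ball of radius
    [r] around this point. *)
Definition box_near (c r x1 x2 : R) (P : R -> R -> Prop) : Prop :=
  exists z1 z2, [/\ 0 <= z1 - c * r /\ z1 + c * r <= 1,
    0 <= z2 - c * r /\ z2 + c * r <= 1,
    `|z1 - x1| <= r / 2 - c * r, `|z2 - x2| <= r / 2 - c * r &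
    forall y1 y2, `|y1 - z1| < c * r -> `|y2 - z2| < c * r -> P y1 y2].

Lemma box_nearC c r x1 x2 P : box_near c r x2 x1 (fun y2 y1 => P y1 y2) ->
  box_near c r x1 x2 P.
Proof.
by move=> [z2 [z1 [? ? ? ? h]]]; exists z1, z2; split=> // *; exact: h.
Qed.

Lemma box_nearS c r x1 x2 (P Q : R -> R -> Prop) :
  (forall y1 y2, P y1 y2 -> Q y1 y2) ->
  box_near c r x1 x2 P -> box_near c r x1 x2 Q.
Proof.
move=> PQ [z1 [z2 [? ? ? ? h]]]; exists z1, z2; split=> // *.
by apply: PQ; exact: h.
Qed.

End boxes.

Section strips.
Context {R : realType} {p q : nat}.
Variables (a : 'I_p -> R) (b : 'I_q -> R) (m : R).
Hypotheses (m_gt0 : 0 < m) (a_ge : forall i, m <= a i) (b_ge : forall j, m <= b j).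
Hypotheses (a_sum1 : \sum_i a i = 1) (b_sum1 : \sum_j b j = 1).

Let a_gt0 i : 0 < a i. Proof. exact: lt_le_trans (a_ge i). Qed.
Let b_gt0 j : 0 < b j. Proof. exact: lt_le_trans (b_ge j). Qed.

(** The condition [m * w <= h] makes a ball of radius comparable to [w] fit
    into the strip, so that holes can be searched in it at that scale. *)
Definition flat_strip (j : 'I_q) (n : nat) (x1 x2 : R) : Prop :=
  exists u w v h, [/\ cell a n u w, u <= x1 <= u + w, cell b n v h,
    in_hole b j v h x2 & m * w <= h].

Definition hole_box (i : 'I_p) (j : 'I_q) (n : nat) (x1 x2 : R) : Prop :=
  exists u w v h, [/\ cell a n u w, cell b n v h,
    in_hole a i u w x1 & in_hole b j v h x2].

(** Horizontally, the square has room in the interval of length about [h] given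
    by [coarse_interval]; vertically, in the row [j] of the cell of [x2].  Along
    that interval the column cells vary, but all are at most [h / m] wide. *)
Lemma box_near_flat_strip j n u w v h x1 x2 :
  cell a n u w -> u <= x1 <= u + w -> cell b n v h -> v <= x2 <= v + h ->
  w <= h -> box_near (m ^+ 2 / 8) (4 * h) x1 x2 (flat_strip j n).
Proof.
move=> cu ux cv vx wh.
have [v0 h0 vh1] := cell_sub_unit b_gt0 b_sum1 cv.
have h1 : h <= 1 by lra.
have [t [l [[t0 tl1 tx hl mlh] cov]]] :=
  coarse_interval a_gt0 a_sum1 a_ge cu ux wh h1.
have bj := b_ge j; have cj := offset_ge0 b_gt0 j.
have cj1 := offset_digit_le1 b_gt0 b_sum1 j.
have m1 : m <= 1 by lra.
have mm : m ^+ 2 <= m by rewrite expr2 ger_pMl.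
have rhoE : m ^+ 2 / 8 * (4 * h) = m ^+ 2 * h / 2 by field.
set rho := m ^+ 2 / 8 * (4 * h) in rhoE *.
have rho0 : 0 < rho by rewrite rhoE divr_gt0 // mulr_gt0 // exprn_gt0.
have rhom : 2 * rho <= m * h by rewrite rhoE mulrC divfK // ler_pM2r.
have mh : m * h <= h by rewrite ger_pMl.
have [|z1 [z1x z1l z1r]] := inner_point tx (ltW rho0); first by lra.
have hb : m * h <= h * b j by rewrite mulrC ler_pM2l.
have hc : 0 <= h * offset b j by rewrite mulr_ge0 // ltW.
have hbc : h * (offset b j + b j) <= h by rewrite ger_pMr.
(* Any place in the row [j] will do: its distance to [x2] is at most [h]. *)
have := @inner_point R (v + h * offset b j) (h * b j) (v + h * offset b j) rho.
case; [by apply/andP; split; lra|exact: ltW|lra|] => z2 [z2x z2l z2r].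
exists z1, z2; split; [lra|lra| | |].
- by apply: le_trans z1x _; lra.
- by rewrite ler_norml; lra.
move=> y1 y2; rewrite !ltr_norml => y1z y2z.
have [|u' [w' [cu' uy wl]]] := cov y1; first by lra.
exists u', w', v, h; split => //; first by rewrite /in_hole; lra.
by apply: le_trans mlh; rewrite ler_pM2l.
Qed.

(** At scale [w] the height of the strip is not smaller than the width up to
    constants, so only the horizontal position has to be moved into the column
    [i], while the vertical one is essentially kept.  The factor [m ^ 2] comes
    from [m * w <= h] and from the height [b j * h] of the row. *)
Lemma box_near_hole_box i j n u w v h x1 x2 :
  cell a n u w -> u <= x1 <= u + w -> cell b n v h -> in_hole b j v h x2 ->
  m * w <= h -> box_near (m ^+ 2 / 8) (4 * w) x1 x2 (hole_box i j n).
Proof.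
move=> cu ux cv vx wh.
have [v0 h0 vh1] := cell_sub_unit b_gt0 b_sum1 cv.
have [u0 w0 uw1] := cell_sub_unit a_gt0 a_sum1 cu.
have bj := b_ge j; have cj := offset_ge0 b_gt0 j.
have cj1 := offset_digit_le1 b_gt0 b_sum1 j.
have ai := a_ge i; have ci := offset_ge0 a_gt0 i.
have ci1 := offset_digit_le1 a_gt0 a_sum1 i.
have m1 : m <= 1 by lra.
have mm : m ^+ 2 <= m by rewrite expr2 ger_pMl.
have rhoE : m ^+ 2 / 8 * (4 * w) = m ^+ 2 * w / 2 by field.
set rho := m ^+ 2 / 8 * (4 * w) in rhoE *.
have rho0 : 0 < rho by rewrite rhoE divr_gt0 // mulr_gt0 // exprn_gt0.
have rhom : 2 * rho <= m * w by rewrite rhoE mulrC divfK // ler_pM2r.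
have mw : m * w <= w by rewrite ger_pMl.
have wa : m * w <= w * a i by rewrite mulrC ler_pM2l.
have wc : 0 <= w * offset a i by rewrite mulr_ge0 // ltW.
have wac : w * (offset a i + a i) <= w by rewrite ger_pMr.
have hb : 2 * rho <= h * b j.
  rewrite rhoE mulrC divfK // expr2 -mulrA mulrC.
  by apply: ler_pM => //; [rewrite mulr_ge0 // ltW|exact: ltW].
have hc : 0 <= h * offset b j by rewrite mulr_ge0 // ltW.
have hbc : h * (offset b j + b j) <= h by rewrite ger_pMr.
have := @inner_point R (u + w * offset a i) (w * a i) (u + w * offset a i) rho.
case; [by apply/andP; split; lra|exact: ltW|lra|] => z1 [z1x z1l z1r].
have := @inner_point R (v + h * offset b j) (h * b j) x2 rho.
case; [by move: vx; rewrite /in_hole; lra|exact: ltW|lra|] => z2 [z2x z2l z2r].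
exists z1, z2; split; [lra|lra| | |].
- by rewrite ler_norml; lra.
- by apply: le_trans z2x _; lra.
move=> y1 y2; rewrite !ltr_norml => y1z y2z.
by exists u, w, v, h; split => //; rewrite /in_hole; lra.
Qed.

End strips.

Section two_scales.
Context {R : realType} {p q : nat}.
Variables (a : 'I_p -> R) (b : 'I_q -> R) (m : R).
Hypotheses (p_ge2 : (2 <= p)%N) (q_ge2 : (2 <= q)%N) (m_gt0 : 0 < m).
Hypotheses (a_ge : forall i, m <= a i) (b_ge : forall j, m <= b j).
Hypotheses (a_sum1 : \sum_i a i = 1) (b_sum1 : \sum_j b j = 1).
Variables (i : 'I_p) (j : 'I_q).

Let a_gt0 k : 0 < a k. Proof. exact: lt_le_trans (a_ge k). Qed.
Let b_gt0 k : 0 < b k. Proof. exact: lt_le_trans (b_ge k). Qed.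

(** The strip follows the long side of the rectangle, hence the two cases. *)
Definition strip n x1 x2 : Prop :=
  flat_strip a b m j n x1 x2 \/ flat_strip b a m i n x2 x1.

Lemma box_near_strip n x1 x2 : 0 <= x1 <= 1 -> 0 <= x2 <= 1 ->
  exists s, [/\ m ^+ n <= s, s <= (1 - m) ^+ n &
    box_near (m ^+ 2 / 8) (4 * s) x1 x2 (strip n)].
Proof.
move=> /(cell_cover a_gt0 a_sum1 n)[u [w [cu ux]]].
move=> /(cell_cover b_gt0 b_sum1 n)[v [h [cv vx]]].
have [wh|hw] := leP w h.
  exists h; split.
  - exact: cell_width_ge cv.
  - exact: cell_width_le cv.
  - have := box_near_flat_strip m_gt0 a_ge b_ge a_sum1 b_sum1 j cu ux cv vx wh.
    by apply: box_nearS => *; left.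
exists w; split.
- exact: cell_width_ge cu.
- exact: cell_width_le cu.
- have := box_near_flat_strip m_gt0 b_ge a_ge b_sum1 a_sum1 i cv vx cu ux (ltW hw).
  by move=> near; apply: box_nearC; apply: box_nearS near => *; right.
Qed.

Lemma box_near_hole n x1 x2 : strip n x1 x2 ->
  exists s, [/\ m ^+ n <= s, s <= (1 - m) ^+ n &
    box_near (m ^+ 2 / 8) (4 * s) x1 x2 (hole_box a b i j n)].
Proof.
case=> [[u [w [v [h [cu ux cv vx wh]]]]]|[v [h [u [w [cv vx cu ux wh]]]]]].
  exists w; split.
  - exact: cell_width_ge cu.
  - exact: cell_width_le cu.
  - exact: box_near_hole_box ux cv vx wh.
exists h; split.
- exact: cell_width_ge cv.
- exact: cell_width_le cv.
- apply: box_nearC.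
  have := box_near_hole_box m_gt0 b_ge a_ge b_sum1 a_sum1 j cv vx cu ux wh.
  apply: box_nearS => y2 y1 [v1 [h1 [u1 [w1 [? ? ? ?]]]]].
  by exists u1, w1, v1, h1.
Qed.

End two_scales.

(** * The Euclidean unit square *)

Section unit_square_metric.
Context {R : realType}.
Implicit Types (x y : unit_square R) (r : R).

Lemma origin_in_unit_square : in_unit_square ((0, 0) : R * R).
Proof. by rewrite /in_unit_square /= lexx ler01. Qed.

Definition origin : unit_square R :=
  exist (fun z : R * R => in_unit_square z) (0, 0) origin_in_unit_square.

Lemma ball_unit_squareE x r y :
  ball x r y <-> eucl_dist (to_plane x) (to_plane y) < r.
Proof. by rewrite ballEmdist. Qed.

Lemma ball_coord x r y : ball x r y ->
  `|(to_plane x).1 - (to_plane y).1| < r /\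
  `|(to_plane x).2 - (to_plane y).2| < r.
Proof.
move=> /ball_unit_squareE xy; split; apply: le_lt_trans xy;
  rewrite -sqrtr_sqr; apply: ler_wsqrtr.
- by rewrite lerDl sqr_ge0.
- by rewrite lerDr sqr_ge0.
Qed.

Lemma coord_ball x r y :
  `|(to_plane x).1 - (to_plane y).1| < r / 2 ->
  `|(to_plane x).2 - (to_plane y).2| < r / 2 -> ball x r y.
Proof.
move=> h1 h2; apply/ball_unit_squareE; rewrite /eucl_dist.
set s := _ - _ in h1 *; set t := (X in _ + X ^+ 2).
have r0 : 0 < r by have := normr_ge0 s; lra.
rewrite -[ltRHS](ger0_norm (ltW r0)) -sqrtr_sqr ltr_sqrt ?exprn_gt0 //.
have sq (c : R) : `|c| < r / 2 -> c ^+ 2 < r ^+ 2 / 4.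
  move=> cr; rewrite -real_normK ?num_real //.
  rewrite (_ : r ^+ 2 / 4 = (r / 2) ^+ 2); last by field.
  by rewrite ltrXn2r // ?nnegrE //; lra.
have := sq _ h1; have := sq _ h2; have := exprn_gt0 2 r0; rewrite -/s -/t; lra.
Qed.

Lemma unit_square_mem x : in_unit_square (to_plane x).
Proof. exact: svalP x. Qed.

Lemma box_near_ball (c r : R) x (P : R -> R -> Prop) : 0 < c * r ->
  box_near c r (to_plane x).1 (to_plane x).2 P ->
  exists y, ball y (c * r) `<=`
    ball x r `&` [set z | P (to_plane z).1 (to_plane z).2].
Proof.
move=> cr0 [z1 [z2 [[z10 z11] [z20 z21] z1x z2x zP]]].
have zsq : in_unit_square (z1, z2).
  by apply/andP; split; apply/andP; split => /=; lra.
exists (exist _ (z1, z2) zsq) => y /ball_coord /= [y1 y2].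
move: z1x z2x; rewrite !ler_norml => z1x z2x.
move: (y1) (y2); rewrite !ltr_norml => y1' y2'.
split; last by apply: zP; rewrite distrC.
by apply: coord_ball; rewrite ltr_norml; lra.
Qed.

(** Cut the square into a grid of mesh less than [e / 2] and choose a point of
    [A] in each grid square that meets [A]. *)
Lemma unit_square_net (A : set (unit_square R)) (e : R) : 0 < e ->
  exists2 s : seq (unit_square R), [set` s] `<=` A &
     A `<=` \bigcup_(x in [set` s]) ball x e.
Proof.
move=> e0; pose N := Num.truncn (2 / e).
have Ne : 1 < N.+1%:R * (e / 2).
  have /truncn_itv/andP[_] : 0 <= 2 / e by rewrite divr_ge0 // ltW.
  rewrite -/N ltr_pdivrMr // => h; lra.
pose idx (t : R) : 'I_N.+2 := inord (Num.truncn (t * N.+1%:R)).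
have idxP t t' : 0 <= t <= 1 -> 0 <= t' <= 1 -> idx t = idx t' ->
    `|t - t'| < e / 2.
  have tr s : 0 <= s <= 1 -> (idx s)%:R <= s * N.+1%:R < (idx s)%:R + 1.
    move=> /andP[s0 s1]; have sN : 0 <= s * N.+1%:R by rewrite mulr_ge0.
    have /andP[h1 h2] := truncn_itv sN.
    rewrite /idx inordK; first by rewrite h1 natr1.
    rewrite ltnS -(ler_nat R); apply: le_trans h1 _.
    by rewrite ler_piMl.
  move=> /tr + /tr + tt'; rewrite tt' => /andP[h1 h2] /andP[h3 h4].
  rewrite -(ltr_pM2l (ltr0Sn R N)) (le_lt_trans _ Ne) //.
  have N0 : 0 < N.+1%:R :> R by [].
  rewrite -[X in X * _]gtr0_norm // -normrM ltW // ltr_norml; lra.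
pose key x := (idx (to_plane x).1, idx (to_plane x).2).
have [f fP] : {f : 'I_N.+2 * 'I_N.+2 -> unit_square R &
    forall k x, A x -> key x = k -> A (f k) /\ key (f k) = k}.
  apply: (@choice _ _ (fun k y => forall x, A x -> key x = k -> A y /\ key y = k)).
  move=> k; have [[x [Ax xk]]|no] := pselect (exists x, A x /\ key x = k).
    by exists x.
  by exists origin => x Ax xk; case: no; exists x.
exists [seq f k | k <- enum [pred k | `[< A (f k) >]]].
  by move=> x /= /mapP[k]; rewrite mem_enum => /asboolP Afk ->.
move=> x Ax; have [Af kf] := fP _ x Ax erefl.
exists (f (key x)) => /=.
  by apply/mapP; exists (key x); rewrite // mem_enum; apply/asboolP.
have /andP[x1 x2] := unit_square_mem x.
have /andP[f1 f2] := unit_square_mem (f (key x)).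
by case: kf => k1 k2; apply: coord_ball; apply: idxP.
Qed.

End unit_square_metric.

(** * Thinness of the carpet *)

Lemma unit_square_finite {R : realType}
    (mu : {outer_measure set (unit_square R) -> \bar R}) :
  doubling mu -> (mu setT < +oo)%E.
Proof.
move=> [_ [C C1 hC]].
have [_ _ fin] := hC origin 4 ltac:(lra).
apply: le_lt_trans fin; apply: (@le_trans _ _ (mu (ball origin 4))).
  apply: le_outer_measure => x _; have /andP[h1 h2] := unit_square_mem x.
  by apply: coord_ball => /=; rewrite ltr_norml; lra.
by rewrite lee_pemull ?outer_measure_ge0 // lee_fin.
Qed.

Lemma borel_regular_open {R : realType} {X : topologicalType}
    (mu : {outer_measure set X -> \bar R}) (U : set X) :
  borel_regular mu -> open U -> mu.-caratheodory U.
Proof. by move=> [+ _] oU; apply; exact: sub_sigma_algebra. Qed.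

Lemma lower_bound_gt0 {R : realType} (p : nat) (a : 'I_p -> R) :
  (forall i, 0 < a i) -> exists2 m, 0 < m & forall i, m <= a i.
Proof.
move=> a0; exists (\big[Num.min/1]_i a i).
  by elim/big_ind : _ => // x y x0 y0; rewrite lt_min x0.
by move=> i; rewrite (bigD1 i) //= ge_min lexx.
Qed.

Section product_subdivision.
Context {R : realType} {p q : nat}.
Variables (a : 'I_p -> R) (b : 'I_q -> R).
Hypotheses (p_ge2 : (2 <= p)%N) (q_ge2 : (2 <= q)%N).
Hypotheses (a_gt0 : forall i, 0 < a i) (a_sum1 : \sum_i a i = 1).
Hypotheses (b_gt0 : forall j, 0 < b j) (b_sum1 : \sum_j b j = 1).
Variables (i0 : 'I_p) (j0 : 'I_q).

Let hole n : set (unit_square R) :=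
  [set x | hole_box a b i0 j0 n (to_plane x).1 (to_plane x).2].

(** The interiors are removed, rather than the holes, so that what remains is
    closed by construction; the balls found near it and inside the holes still
    avoid it, being open.  For each [n], the set is first compared with the
    strips close to it, then these with the holes close to them. *)
Lemma complement_of_holes_null
    (mu : {outer_measure set (unit_square R) -> \bar R}) :
  doubling mu -> mu (~` \bigcup_n (hole n)°) = 0%E.
Proof.
move=> dmu; have muT := unit_square_finite dmu.
case: dmu => breg [C C1 /= hC].
have C0 : 0 <= C by lra.
have mO U : open U -> mu.-caratheodory U by exact: borel_regular_open.
have mB (x : unit_square R) (r : R) : mu.-caratheodory (ball x r).
  exact/mO/metric_ball_open.
have dbl (x : unit_square R) (r : R) : 0 < r ->
  (mu (ball x (2 * r)) <= C%:E * mu (ball x r))%E by move=> /(hC x)[].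
have [ma ma0 a_gea] := lower_bound_gt0 a_gt0.
have [mb mb0 b_geb] := lower_bound_gt0 b_gt0.
pose m := Num.min ma mb.
have m0 : 0 < m by rewrite lt_min ma0.
have a_ge i : m <= a i by rewrite ge_min a_gea.
have b_ge j : m <= b j by rewrite ge_min b_geb orbT.
have m1 : m <= 1.
  have := offset_digit_le1 a_gt0 a_sum1 i0; have := offset_ge0 a_gt0 i0.
  have := a_ge i0; lra.
pose c := m ^+ 2 / 8; have c0 : 0 < c by rewrite divr_gt0 // exprn_gt0.
have [k kc] : exists k : nat, 4 <= 2 ^+ k * c.
  exists (Num.truncn (4 / c)).+1; rewrite -ler_pdivrMr //.
  have : 0 <= 4 / c by rewrite divr_ge0 // ltW.
  move=> /truncn_itv/andP[_ /ltW h]; apply: le_trans h _.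
  by rewrite -natrX ler_nat ltnW // ltn_expl.
set A := ~` _.
have clA : closed A by apply: open_closedC; apply: bigcup_open => n _; exact: open_interior.
(* All rectangles of level [n] have sides at most [(1 - m) ^+ n], so [delta n]
   bounds the radius used at one step, and [2 * delta n] the total displacement. *)
pose delta n : R := 4 * (1 - m) ^+ n.
pose stripped n : set (unit_square R) :=
  [set x | strip a b m i0 j0 n (to_plane x).1 (to_plane x).2].
have scale_gt0 n s : m ^+ n <= s -> 0 < c * (4 * s).
  by move=> ms; rewrite !mulr_gt0 // (lt_le_trans _ ms) // exprn_gt0.
have rmin_gt0 n : 0 < 4 * m ^+ n by rewrite mulr_gt0 // exprn_gt0.
have step1 n : (mu A <= (C ^+ k)%:E *
    mu (stripped n `&` neighborhood A (delta n)))%E.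
  apply: (thick_comparison C0 mB dbl c0 kc (rmin_gt0 n)).
    exact: unit_square_net.
  move=> x Ax; have /andP[x1 x2] := unit_square_mem x.
  have [s [ms sM near]] :=
    box_near_strip p_ge2 q_ge2 m0 a_ge b_ge a_sum1 b_sum1 i0 j0 n x1 x2.
  have [y yP] := box_near_ball (scale_gt0 n s ms) near.
  exists (4 * s), y; split; first by rewrite ler_pM2l.
  move=> z /yP[xz sz]; split=> //; split=> //; exists x => //.
  by apply: le_ball xz; rewrite ler_pM2l.
have step2 n : (mu (stripped n `&` neighborhood A (delta n)) <= (C ^+ k)%:E *
    mu (neighborhood A (2 * delta n) `\` A))%E.
  apply: (thick_comparison C0 mB dbl c0 kc (rmin_gt0 n)).
    exact: unit_square_net.
  move=> x [sx [x0 Ax0 x0x]].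
  have [s [ms sM near]] :=
    box_near_hole p_ge2 q_ge2 m0 a_ge b_ge a_sum1 b_sum1 sx.
  have [y yP] := box_near_ball (scale_gt0 n s ms) near.
  exists (4 * s), y; split; first by rewrite ler_pM2l.
  move=> z yz; have [xz hz] := yP z yz; split=> //; split.
    exists x0 => //; apply: (@le_ball _ _ _ (delta n + 4 * s)).
      by have : 4 * s <= delta n; [rewrite ler_pM2l|lra].
    exact: ball_triangle x0x xz.
  (* The whole open ball around [y] lies in the holes, so [z] is interior. *)
  apply; exists n => //.
  have yh : ball y (c * (4 * s)) `<=` hole n by move=> t /yP[].
  by move: yh; rewrite open_subsetE; [apply|exact: metric_ball_open].
pose K := C ^+ k * C ^+ k.
apply: (@outer_measure_shell_eq0 _ _ mu A K (fun n => 2 * delta n)) => //.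
- by rewrite mulr_ge0 ?exprn_ge0.
- apply/nonincreasing_seqP => n; rewrite /delta exprS !ler_pM2l //.
  by rewrite ler_piMl ?exprn_ge0 //; lra.
- have -> : (0 : R) = 2 * (4 * 0) by rewrite !mulr0.
  apply: cvgMr; apply: cvgMr; apply: cvg_expr.
  by rewrite ger0_norm; lra.
- move=> n; apply: le_trans (step1 n) _; rewrite EFinM -muleA.
  by rewrite lee_wpmul2l ?lee_fin ?exprn_ge0.
Qed.

End product_subdivision.

Theorem theorem1p5 (R : realType) (E : set (R * R)) (hE : is_baranski_carpet E) :
  thin_for_doubling (@to_plane R @^-1` E).
Proof.
move: hE => [p [q [a [b [S [[p2 q2] [a0 a1] [b0 b1] [[i0 j0] ijS] ->]]]]]].
move=> mu dmu; apply/eqP; rewrite eq_le outer_measure_ge0 andbT.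
rewrite -(complement_of_holes_null p2 q2 a0 a1 b0 b1 i0 j0 dmu).
apply: le_outer_measure => x Ex [n _ /interior_subset].
move=> [u [w [v [h [cu cv hu hv]]]]].
exact: (carpet_avoids_holes a0 a1 b0 b1 ijS cu cv hu hv) (Ex n.+1 isT).
Qed.
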